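(* Let $z,w\in\Lambda$ and let $p\ge 1$ be an integer. If $p=1$, then $$\Vert zw\Vert_1\le \Vert z\Vert_1\,\Vert w\Vert_1 .$$ If $p>1$, then $$\Vert zw\Vert_p^p\le \Vert z\Vert_1^p\,\Vert w\Vert_{2^{p-1}}\prod_{k=1}^{p-1}\Vert w\Vert_{2^k}$$ and $$\Vert zw\Vert_p^p\le \Vert w\Vert_1^p\,\Vert z\Vert_{2^{p-1}}\prod_{k=1}^{p-1}\Vert z\Vert_{2^k}.$$
   Context: $\Lambda$ is the complex Grassmann algebra on countably many generators $i_1,i_2,\dots$ with relations $i_ni_m+i_mi_n=0$ for all $n,m$ (in particular $i_n^2=0$). Only finite sums are allowed in $\Lambda$, i.e. $\Lambda=\bigcup_{N}\Lambda_N$, where $\Lambda_N$ is the Grassmann algebra generated by $i_1,\dots,i_N$. Let $\mathfrak I$ be the set of all finite tuples $\alpha=(a_1,\dots,a_t)$, $t\ge1$, of positive integers with $a_1<\cdots<a_t$, put $i_\alpha=i_{a_1}\cdots i_{a_t}$, and let $\mathfrak I_0=\mathfrak I\cup\{0\}$ with $i_0=1$. Each $z\in\Lambda$ is written uniquely as a finite sum $z=\sum_{\alpha\in\mathfrak I_0}z_\alpha i_\alpha$ with $z_\alpha\in\mathbb C$. For $p\ge 1$, $\Vert z\Vert_p=\left(\sum_{\alpha\in\mathfrak I_0}|z_\alpha|^p\right)^{1/p}$. *)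

(* Defs.v *)
From HB Require Import structures.
From mathcomp Require Import all_boot all_order all_algebra finmap.
From mathcomp Require Import complex.
From mathcomp Require Import reals exp.
From mathcomp Require Import monalg.

Set Implicit Arguments.
Unset Strict Implicit.
Unset Printing Implicit Defensive.

Import Order.TTheory GRing.Theory Num.Theory.

Local Open Scope fset_scope.
Local Open Scope ring_scope.
Local Open Scope complex_scope.

(* A multi-index a_1 < ... < a_t is represented by the finite set of its      *)
(* entries; the empty set plays the role of the multi-index 0, for which      *)
(* i_0 = 1. The generators are numbered from 0, so that n : nat stands for    *)
(* the (n+1)-th generator i_(n+1).                                            *)
Notation multiindex := {fset nat}.

Section Sign.
Variable R : realType.
Implicit Types A B C : multiindex.

Definition inversions A B : nat :=
  (\sum_(a <- A) \sum_(b <- B) (b < a)%N)%N.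

(* i_A * i_B = blade_sign A B * i_(A `|` B): sorting the concatenation of two *)
(* increasing tuples costs one sign change per inversion, and the product     *)
(* vanishes when a generator is repeated.                                     *)
Definition blade_sign A B : R[i] :=
  if [disjoint A & B]%fset then (-1) ^+ inversions A B else 0.

Lemma sum_fsetU A B (F : nat -> nat) : [disjoint A & B]%fset ->
  (\sum_(x <- A `|` B) F x = \sum_(x <- A) F x + \sum_(x <- B) F x)%N.
Proof.
move=> dAB; rewrite -big_cat; apply: perm_big; apply: uniq_perm.
- exact: fset_uniq.
- rewrite cat_uniq !fset_uniq andbT /=; apply/hasPn => x xB.
  by apply: contraL dAB => xA; apply/fdisjointP => /(_ x xA); rewrite xB.
by move=> x; rewrite in_fsetU mem_cat.
Qed.

Lemma blade_sign0l A : blade_sign fset0 A = 1.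
Proof. by rewrite /blade_sign fdisjoint0X /inversions big_seq_fset0. Qed.

Lemma blade_sign0r A : blade_sign A fset0 = 1.
Proof.
rewrite /blade_sign fdisjointX0 /inversions big1 // => a _.
by rewrite big_seq_fset0.
Qed.

Lemma blade_signA A B C :
  blade_sign A B * blade_sign (A `|` B) C =
  blade_sign B C * blade_sign A (B `|` C).
Proof.
rewrite /blade_sign fdisjointUX fdisjointXU.
case dAB: [disjoint A & B]%fset; case dAC: [disjoint A & C]%fset;
  case dBC: [disjoint B & C]%fset; rewrite /= ?(mul0r, mulr0) //.
rewrite -!exprD; congr (_ ^+ _); rewrite /inversions sum_fsetU //.
rewrite [in RHS](eq_bigr _ (fun a _ => sum_fsetU _ dBC)) big_split /=.
by rewrite addnA addnC.
Qed.

End Sign.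

Section Grassmann.
Variable R : realType.

(* The underlying vector space: finitely supported families z@_A of complex   *)
(* coefficients.                                                              *)
Definition grassmann := {malg R[i][multiindex]}.

HB.instance Definition _ := GRing.Lmodule.on grassmann.

Definition gmul (z w : grassmann) : grassmann :=
  \sum_(A <- msupp z) \sum_(B <- msupp w)
    << z@_A * w@_B * blade_sign R A B *g (A `|` B) >>.

Definition blade (A : multiindex) : grassmann := << 1 *g A >>.

Definition gen (n : nat) : grassmann := blade [fset n]%fset.

Implicit Types z w u : grassmann.

Lemma gmulEw (d1 d2 : {fset multiindex}) z w :
  (msupp z `<=` d1) -> (msupp w `<=` d2) ->
  gmul z w = \sum_(A <- d1) \sum_(B <- d2)
    << z@_A * w@_B * blade_sign R A B *g (A `|` B) >>.
Proof.
move=> le1 le2; rewrite /gmul (big_fset_incl _ le1) /=.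
  apply: eq_bigr => A _; apply: big_fset_incl => // B _ /mcoeff_outdom ->.
  by rewrite mulr0 mul0r monalgU0.
move=> A _ /mcoeff_outdom zA.
by rewrite big1 // => B _; rewrite zA !mul0r monalgU0.
Qed.

Lemma gmul0z : left_zero 0 gmul.
Proof. by move=> z; rewrite /gmul msupp0 big_seq_fset0. Qed.

Lemma gmulz0 : right_zero 0 gmul.
Proof. by move=> z; rewrite /gmul big1 // => A _; rewrite msupp0 big_seq_fset0. Qed.

Lemma gmulDl : left_distributive gmul +%R.
Proof.
move=> z w u; have S := fsubset_refl (msupp u).
rewrite (gmulEw (msuppD_le z w) S) (gmulEw (fsubsetUl _ (msupp w)) S).
rewrite (gmulEw (fsubsetUr (msupp z) _) S) -big_split /=.
apply: eq_bigr => A _; rewrite -big_split /=; apply: eq_bigr => B _.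
by rewrite mcoeffD !mulrDl monalgUD.
Qed.

Lemma gmulDr : right_distributive gmul +%R.
Proof.
move=> u z w; have S := fsubset_refl (msupp u).
rewrite (gmulEw S (msuppD_le z w)) (gmulEw S (fsubsetUl _ (msupp w))).
rewrite (gmulEw S (fsubsetUr (msupp z) _)) -big_split /=.
apply: eq_bigr => A _; rewrite -big_split /=; apply: eq_bigr => B _.
by rewrite mcoeffD mulrDr mulrDl monalgUD.
Qed.

Lemma gmulUU (a b : R[i]) (A B : multiindex) :
  gmul << a *g A >> << b *g B >> = << a * b * blade_sign R A B *g (A `|` B) >>.
Proof. by rewrite (gmulEw msuppU_le msuppU_le) !big_seq_fset1 !mcoeffUU. Qed.

Lemma gmul_suml I (r : seq I) (F : I -> grassmann) w :
  gmul (\sum_(i <- r) F i) w = \sum_(i <- r) gmul (F i) w.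
Proof. exact: (big_morph (gmul^~ w) (fun x y => gmulDl x y w) (gmul0z w)). Qed.

Lemma gmul_sumr I (r : seq I) (F : I -> grassmann) w :
  gmul w (\sum_(i <- r) F i) = \sum_(i <- r) gmul w (F i).
Proof. exact: (big_morph (gmul w) (gmulDr w) (gmulz0 w)). Qed.

Lemma gmulEl z w : gmul z w = \sum_(A <- msupp z) gmul << z@_A *g A >> w.
Proof. by rewrite [in LHS](monalgE z) gmul_suml. Qed.

Lemma gmulEr z w : gmul z w = \sum_(A <- msupp w) gmul z << w@_A *g A >>.
Proof. by rewrite [in LHS](monalgE w) gmul_sumr. Qed.

Lemma gmulA : associative gmul.
Proof.
move=> z w u; rewrite (gmulEl z (gmul w u)) (gmulEl z w) gmul_suml.
apply: eq_bigr => A _; rewrite (gmulEl w u) (gmulEr _ w) gmul_sumr gmul_suml.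
apply: eq_bigr => B _; rewrite !(gmulEr _ u) gmul_sumr.
apply: eq_bigr => C _.
rewrite !gmulUU fsetUA; congr (mkmalgU _ _).
rewrite -!mulrA; do 2![apply/(congr1 ( *%R _))].
by rewrite [RHS]mulrCA blade_signA.
Qed.

Lemma gmul1z : left_id (blade fset0) gmul.
Proof.
move=> z; rewrite [in LHS](monalgE z) gmul_sumr [RHS]monalgE.
by apply: eq_bigr => A _; rewrite gmulUU mul1r blade_sign0l mulr1 fset0U.
Qed.

Lemma gmulz1 : right_id (blade fset0) gmul.
Proof.
move=> z; rewrite [in LHS](monalgE z) gmul_suml [RHS]monalgE.
by apply: eq_bigr => A _; rewrite gmulUU mulr1 blade_sign0r mulr1 fsetU0.
Qed.

Lemma blade0_neq0 : blade fset0 != 0.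
Proof. by rewrite monalgU_eq0 oner_eq0. Qed.

HB.instance Definition _ := GRing.Zmodule_isNzRing.Build grassmann
  gmulA gmul1z gmulz1 gmulDl gmulDr blade0_neq0.

Lemma gscaleU (c a : R[i]) (A : multiindex) :
  c *: (<< a *g A >> : grassmann) = << c * a *g A >>.
Proof. by apply/malgP => B; rewrite mcoeffZ !mcoeffU mulrnAr. Qed.

Lemma gscaleAl (c : R[i]) z w : c *: (z * w) = (c *: z) * w.
Proof.
change (c *: gmul z w = gmul (c *: z) w).
rewrite (gmulEl z w) [in RHS](monalgE z) !scaler_sumr gmul_suml.
apply: eq_bigr => A _; rewrite gscaleU !(gmulEr _ w) scaler_sumr.
by apply: eq_bigr => B _; rewrite !gmulUU gscaleU !mulrA.
Qed.

Lemma gscaleAr (c : R[i]) z w : c *: (z * w) = z * (c *: w).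
Proof.
change (c *: gmul z w = gmul z (c *: w)).
rewrite (gmulEr z w) [in RHS](monalgE w) !scaler_sumr gmul_sumr.
apply: eq_bigr => B _; rewrite gscaleU !(gmulEl z) scaler_sumr.
by apply: eq_bigr => A _; rewrite !gmulUU gscaleU !mulrA [c * _]mulrC.
Qed.

HB.instance Definition _ := GRing.Lmodule_isLalgebra.Build R[i] grassmann gscaleAl.
HB.instance Definition _ := GRing.Lalgebra_isAlgebra.Build R[i] grassmann gscaleAr.

(* The following lemmas identify this algebra as the Grassmann algebra on the *)
(* generators gen n, with its basis of ordered monomials.                     *)
Lemma bladeM (A B : multiindex) :
  blade A * blade B = blade_sign R A B *: blade (A `|` B).
Proof. by rewrite /GRing.mul /= gmulUU gscaleU !mul1r mulr1. Qed.

Lemma gen_anticomm n m : gen n * gen m + gen m * gen n = 0.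
Proof.
rewrite !bladeM fsetUC -scalerDl /blade_sign /inversions !big_seq_fset1.
rewrite !fdisjoint1X !in_fset1 [n == m]eq_sym.
by case: ltngtP => _; rewrite /= ?expr0 ?expr1 ?subrr ?addNr ?addr0 ?scale0r.
Qed.

Lemma bladeE (A : multiindex) : blade A = \prod_(a <- sort leq A) gen a.
Proof.
have: sorted ltn (sort leq A).
  by rewrite ltn_sorted_uniq_leq sort_uniq fset_uniq (sort_sorted leq_total).
have: A =i sort leq A by move=> x; rewrite mem_sort.
move: (sort leq A) => s; elim: s A => [|a r IHr] A eA sr.
  by rewrite big_nil (_ : A = fset0) //; apply/fsetP => x; rewrite eA in_fset0.
have sr' := path_sorted sr.
pose B := [fset x in r]%fset.
have eB : B =i r by move=> x; rewrite in_fset.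
rewrite big_cons -(IHr B eB sr').
have ltar x : x \in r -> (a < x)%N.
  by move: sr => /=; rewrite (path_sortedE ltn_trans) => /andP[/allP h _] /h.
rewrite bladeM /blade_sign fdisjoint1X eB.
have -> : a \notin r by apply/negP => /ltar; rewrite ltnn.
rewrite /inversions big_seq_fset1 big1_seq; last first.
  by move=> x /andP[_]; rewrite eB => /ltar h; rewrite ltnNge ltnW.
rewrite expr0 scale1r; congr blade; apply/fsetP => x.
by rewrite eA in_cons in_fsetU in_fset1 eB.
Qed.

Lemma grassmannE z : z = \sum_(A <- msupp z) z@_A *: blade A.
Proof.
rewrite [LHS]monalgE; apply: eq_bigr => A _.
by rewrite /blade gscaleU mulr1.
Qed.

(* The p-norm; it is meant for p >= 1, and Normc.normc is the real-valued     *)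
(* modulus of a complex number.                                               *)
Definition pnorm (p : R) (z : grassmann) : R :=
  (\sum_(A <- msupp z) Normc.normc z@_A `^ p) `^ p^-1.

End Grassmann.

(* Main.v *)
(* Multiplication by i_A sends distinct basis blades to 0 or, up to sign, to  *)
(* distinct blades; writing z as a combination of blades, Jensen's inequality *)
(* with weights |z_A| gives ||zw||_p <= ||z||_1 ||w||_p, and symmetrically    *)
(* ||zw||_p <= ||w||_1 ||z||_p. Then ||w||_p^p = sum |w_B| ... |w_B|          *)
(* (p factors) is bounded by Hoelder's inequality with the exponents          *)
(* 2, 4, ..., 2^(p-1), 2^(p-1), whose inverses sum to 1.                      *)

Require Import Defs.
From mathcomp Require Import all_boot all_order all_algebra.
From mathcomp Require Import reals.
From mathcomp Require Import ring lra.
From mathcomp Require Import finmap complex exp monalg.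

Set Implicit Arguments.
Unset Strict Implicit.
Unset Printing Implicit Defensive.

Import Order.TTheory GRing.Theory Num.Theory.

Local Open Scope ring_scope.

(** Passing to moduli removes the signs: the coefficient of [z * w] at [C] is at most the sum of
    |z_A| |w_B| over disjoint [A], [B] with union [C] ([normc_mcoeffM]). For fixed [A] this relation
    between [B] and [C] is a partial injection, so [kernel_young], which rests on Jensen's
    inequality, yields the bound by the 1-norm of one factor and the p-norm of the other
    ([pnormMl_exp], [pnormMr_exp]); for p = 1 nothing more is needed. For p > 1 the remaining p-norm
    is split into dyadic norms by [lpnorm_dyadic_holder], an iterated Cauchy-Schwarz inequality.
    Writing p as [n.+1] keeps the powers of sums polynomial, so real exponents occur only in the
    norms. *)

(** * Jensen's inequality and sums over partial injections *)

(** Convexity: the graph of x^(n+1) lies above its tangent at [m]. The induction multiplies the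
    previous case by [m] and adds [h], a product of two factors of the same sign. *)
Lemma power_tangent (R : realFieldType) (m b : R) n :
  0 <= m -> 0 <= b -> n.+1%:R * m ^+ n * b <= b ^+ n.+1 + n%:R * m ^+ n.+1.
Proof.
move=> m0 b0; elim: n => [|n IHn]; first by rewrite !mul1r mul0r addr0.
have h : 0 <= (b ^+ n.+1 - m ^+ n.+1) * (b - m).
  case: (lerP m b) => [mb|/ltW bm].
    by rewrite mulr_ge0 ?subr_ge0 // lerXn2r.
  by rewrite mulr_le0 ?subr_le0 // lerXn2r.
have := ler_wpM2l m0 IHn; move: h; rewrite -!natr1 !exprS.
set x := b ^+ n; set y := m ^+ n => h1 h2; nra.
Qed.

(** Jensen's inequality for x^(n+1) with weights [a], cleared of denominators so that the total
    weight may vanish. *)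
Lemma sum_expr_jensen (R : realFieldType) (I : Type) (r : seq I)
    (a b : I -> R) n :
  (forall i, 0 <= a i) -> (forall i, 0 <= b i) ->
  (\sum_(i <- r) a i * b i) ^+ n.+1 <=
  (\sum_(i <- r) a i) ^+ n * \sum_(i <- r) a i * b i ^+ n.+1.
Proof.
move=> a0 b0; set S := \sum_(i <- r) a i; set T := \sum_(i <- r) a i * b i.
have S0 : 0 <= S by apply: sumr_ge0.
have T0 : 0 <= T by apply: sumr_ge0 => i _; apply: mulr_ge0.
have [Sgt|] := ltP 0 S; last first.
  move=> Sle; have Sz : S = 0 by apply/le_anti; rewrite Sle S0.
  suff -> : T = 0.
    rewrite exprS mul0r mulr_ge0 ?exprn_ge0 //.
    by apply: sumr_ge0 => i _; rewrite mulr_ge0 ?exprn_ge0.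
  rewrite /T; move: Sz; rewrite /S; elim: r {S T S0 T0 Sle} => [|i r IHr].
    by rewrite !big_nil.
  rewrite !big_cons => /eqP; rewrite paddr_eq0 //; last exact: sumr_ge0.
  by move=> /andP[/eqP-> /eqP/IHr->]; rewrite mul0r addr0.
(* The tangent is taken at the weighted mean; summing the tangent inequalities with weights [a] then
   gives the claim. *)
pose m := T / S; have m0 : 0 <= m by rewrite divr_ge0.
have TE : T = m * S by rewrite /m divfK ?gt_eqF.
have: \sum_(i <- r) a i * (n.+1%:R * m ^+ n * b i) <=
      \sum_(i <- r) a i * (b i ^+ n.+1 + n%:R * m ^+ n.+1).
  by apply: ler_sum => i _; rewrite ler_wpM2l ?power_tangent.
under eq_bigr do rewrite mulrCA; rewrite -mulr_sumr -/T.
under [leRHS]eq_bigr do rewrite mulrDr.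
rewrite big_split /= -mulr_suml -/S TE => h.
have {}h : S * m ^+ n.+1 <= \sum_(i <- r) a i * b i ^+ n.+1.
  by move: h; rewrite -natr1 exprS; set x := m ^+ n; lra.
by rewrite exprMn [S ^+ n.+1]exprSr mulrC -mulrA ler_wpM2l ?exprn_ge0.
Qed.

(** Both sums have at most one term; the positive exponent settles the empty case. *)
Lemma sum_at_most_one_exp (R : pzSemiRingType) (J : eqType) (s : seq J)
    (P : pred J) (b : J -> R) n :
  uniq s -> {in P &, forall j j', j = j'} ->
  (\sum_(j <- s | P j) b j) ^+ n.+1 = \sum_(j <- s | P j) b j ^+ n.+1.
Proof.
move=> us P1; have [/hasP[j js Pj]|/hasPn sP] := boolP (has P s); last first.
  by rewrite !big1_seq ?exprS ?mul0r // => j /andP[Pj /sP]; rewrite Pj.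
have only (c : J -> R) : \sum_(k <- s | P k) c k = c j.
  rewrite -big_filter (bigD1_seq j) ?mem_filter ?Pj ?filter_uniq //=.
  rewrite big_filter_cond big1 ?addr0 // => k /andP[Pk].
  by rewrite (P1 k j) ?eqxx.
by rewrite !only.
Qed.

(** Apply Jensen's inequality for each [l], then sum over [l] first: since [K i] is a partial
    injection, each power of [b j] is counted at most once for each [i]. *)
Lemma kernel_young (R : realFieldType) (I J L : eqType)
    (K : I -> J -> L -> bool) (r : seq I) (s : seq J) (t : seq L)
    (a : I -> R) (b : J -> R) n :
  uniq s -> uniq t ->
  (forall i j j' l, K i j l -> K i j' l -> j = j') ->
  (forall i j l l', K i j l -> K i j l' -> l = l') ->
  (forall i, 0 <= a i) -> (forall j, 0 <= b j) ->
  \sum_(l <- t) (\sum_(i <- r) a i * \sum_(j <- s | K i j l) b j) ^+ n.+1 <=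
  (\sum_(i <- r) a i) ^+ n.+1 * \sum_(j <- s) b j ^+ n.+1.
Proof.
move=> us ut Kj Kl a0 b0.
have sa0 : 0 <= \sum_(i <- r) a i by apply: sumr_ge0.
apply: (@le_trans _ _ (\sum_(l <- t) (\sum_(i <- r) a i) ^+ n *
    \sum_(i <- r) a i * \sum_(j <- s | K i j l) b j ^+ n.+1)).
  apply: ler_sum => l _; apply: le_trans (sum_expr_jensen _ _ a0 _) _.
    by move=> i; apply: sumr_ge0.
  rewrite ler_wpM2l ?exprn_ge0 // le_eqVlt; apply/orP; left; apply/eqP.
  apply: eq_bigr => i _; rewrite sum_at_most_one_exp // => j j' h h'.
  exact: Kj h h'.
rewrite -mulr_sumr exprSr -mulrA ler_wpM2l ?exprn_ge0 //.
rewrite exchange_big mulr_suml; apply: ler_sum => i _.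
rewrite -mulr_sumr ler_wpM2l //.
rewrite (exchange_big_dep xpredT) //=; apply: ler_sum => j _.
have [/hasP[l lt Kl0]|/hasPn nK] := boolP (has (K i j) t); last first.
  by rewrite big1_seq ?exprn_ge0 // => l /andP[h /nK]; rewrite h.
rewrite -big_filter (bigD1_seq l) ?mem_filter ?Kl0 ?filter_uniq //=.
rewrite big_filter_cond big1 ?addr0 // => l' /andP[h].
by rewrite (Kl _ _ _ _ h Kl0) eqxx.
Qed.

(** * Cauchy-Schwarz and the dyadic Hoelder inequality *)

(** Lagrange's identity: twice the difference of the two sides is the double sum of squares in
    [h]. *)
Lemma cauchy_schwarz_sum (R : realDomainType) (I : Type) (r : seq I)
    (f g : I -> R) :
  (\sum_(i <- r) f i * g i) ^+ 2 <=
  (\sum_(i <- r) f i ^+ 2) * \sum_(i <- r) g i ^+ 2.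
Proof.
have h : 0 <= \sum_(i <- r) \sum_(j <- r) (f i * g j - f j * g i) ^+ 2.
  by apply: sumr_ge0 => i _; apply: sumr_ge0 => j _; apply: sqr_ge0.
have e : \sum_(i <- r) \sum_(j <- r) (f i * g j - f j * g i) ^+ 2 =
    (\sum_(i <- r) f i ^+ 2) * (\sum_(i <- r) g i ^+ 2) *+ 2
    - (\sum_(i <- r) f i * g i) ^+ 2 *+ 2.
  rewrite mulr2n {2}mulrC expr2 !big_distrlr /= -big_split -sumrMnl -sumrB /=.
  apply: eq_bigr => i _; rewrite -big_split -sumrMnl -sumrB /=.
  by apply: eq_bigr => j _; ring.
by move: h; rewrite e subr_ge0 ler_pMn2r.
Qed.

Section Lpnorm.
Variables (R : realType) (I : Type) (r : seq I).
Implicit Types (f : I -> R) (q : R).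

(** [pnorm] unfolds to this with [f] the moduli of the coefficients; a general [f] lets the
    induction below pass to the squares of [f]. *)
Definition lpnorm q f : R := (\sum_(i <- r) f i `^ q) `^ q^-1.

Lemma lpnorm_ge0 q f : 0 <= lpnorm q f.
Proof. exact: powR_ge0. Qed.

Lemma lpnormXn n f : (forall i, 0 <= f i) ->
  lpnorm n.+1%:R f ^+ n.+1 = \sum_(i <- r) f i ^+ n.+1.
Proof.
move=> f0; rewrite -powR_mulrn ?lpnorm_ge0 // -powRrM mulVf ?pnatr_eq0 //.
rewrite powRr1; last by apply: sumr_ge0 => i _; apply: powR_ge0.
by apply: eq_bigr => i _; rewrite powR_mulrn.
Qed.

(** Squaring the function doubles the exponent, which moves 2^k to 2^(k+1) in the induction
    below. *)
Lemma lpnorm_sqr q f : q != 0 -> (forall i, 0 <= f i) ->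
  lpnorm q (fun i => f i ^+ 2) = lpnorm (2 * q) f ^+ 2.
Proof.
move=> q0 f0; rewrite /lpnorm -powR_mulrn ?powR_ge0 // -powRrM.
have -> : (2 * q)^-1 * 2 = q^-1 by field.
by under eq_bigr do rewrite -powR_mulrn // -powRrM.
Qed.

(* Induction by Cauchy-Schwarz on f^(n+2) = f * f^(n+1), the hypothesis being *)
(* applied to f^2.                                                            *)
Lemma lpnorm_dyadic_holder n f : (forall i, 0 <= f i) ->
  \sum_(i <- r) f i ^+ n.+1 <=
  lpnorm (2 ^+ n) f * \prod_(1 <= k < n.+1) lpnorm (2 ^+ k) f.
Proof.
elim: n f => [|n IHn] f f0.
  by rewrite big_nil mulr1 -(lpnormXn 0).
have rhs0 : 0 <= lpnorm (2 ^+ n.+1) f *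
    \prod_(1 <= k < n.+2) lpnorm (2 ^+ k) f.
  by rewrite mulr_ge0 ?lpnorm_ge0 // prodr_ge0 // => k _; apply: lpnorm_ge0.
rewrite -ler_sqr ?nnegrE //; last by apply: sumr_ge0 => i _; apply: exprn_ge0.
under [X in X ^+ 2 <= _]eq_bigr do rewrite exprS.
apply: le_trans (cauchy_schwarz_sum _ _ _) _.
have -> : \sum_(i <- r) f i ^+ 2 = lpnorm (2 ^+ 1) f ^+ 2.
  by rewrite expr1 (lpnormXn 1).
under [X in _ * X <= _]eq_bigr do rewrite exprAC.
(* The factor [k = 1], squared, is the first Cauchy-Schwarz factor; the rest is the induction
   hypothesis for the squares of [f], with all exponents doubled. *)
rewrite big_ltn // mulrCA exprMn ler_wpM2l ?sqr_ge0 //.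
apply: le_trans (IHn _ (fun i => sqr_ge0 (f i))) _.
have sqrE k : lpnorm (2 ^+ k) (fun i => f i ^+ 2) = lpnorm (2 ^+ k.+1) f ^+ 2.
  rewrite [2 ^+ k.+1]exprS lpnorm_sqr //.
  by apply: expf_neq0; rewrite pnatr_eq0.
rewrite sqrE exprMn [\prod_(2 <= k < n.+2) _]big_add1 -prodrXl.
by rewrite (eq_bigr _ (fun k _ => sqrE k)) lexx.
Qed.

End Lpnorm.

(** * Norm estimates for products in the Grassmann algebra *)

Section GrassmannNorm.
Variable R : realType.
Implicit Types (z w : grassmann R) (A B C : multiindex).

Local Notation normc := Normc.normc.

Lemma normc_ge0 (x : R[i]) : 0 <= normc x.
Proof. by case: x => a b; apply: sqrtr_ge0. Qed.

Lemma le_normc_sum (I : Type) (r : seq I) (F : I -> R[i]) :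
  normc (\sum_(i <- r) F i) <= \sum_(i <- r) normc (F i).
Proof.
elim/big_ind2: _ => [|x a y b xa yb|//]; first by rewrite Normc.normc0.
exact: le_trans (le_normcD a b) (lerD xa yb).
Qed.

(** Holds exactly when the product of the blades of [A] and [B] is, up to sign, the blade of [C]. *)
Definition blade_kernel A B C := [disjoint A & B]%fset && ((A `|` B)%fset == C).

Lemma blade_kernelC A B C : blade_kernel A B C = blade_kernel B A C.
Proof. by rewrite /blade_kernel fdisjoint_sym fsetUC. Qed.

(** [B] is recovered as the difference of [C] and [A]. *)
Lemma blade_kernel_inj A B B' C :
  blade_kernel A B C -> blade_kernel A B' C -> B = B'.
Proof.
have E D : blade_kernel A D C -> D = (C `\` A)%fset.
  move=> /andP[/fdisjointP dis /eqP <-]; apply/fsetP => x.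
  rewrite in_fsetD in_fsetU; case: (boolP (x \in A)) => //= xA.
  by apply/negbTE/dis.
by move=> /E -> /E ->.
Qed.

Lemma blade_kernel_fun A B C C' :
  blade_kernel A B C -> blade_kernel A B C' -> C = C'.
Proof. by move=> /andP[_ /eqP <-] /andP[_ /eqP <-]. Qed.

Lemma normc_blade_sign A B :
  normc (blade_sign R A B) = [disjoint A & B]%fset%:R.
Proof.
rewrite /blade_sign; case: ifP => _; last by rewrite Normc.normc0.
elim: (inversions A B) => [|n IHn]; first by rewrite Normc.normc1.
by rewrite exprS Normc.normcM normcN Normc.normc1 mul1r.
Qed.

Lemma normc_mcoeffM z w C :
  normc (z * w)@_C <=
  \sum_(A <- msupp z) \sum_(B <- msupp w | blade_kernel A B C)
    normc z@_A * normc w@_B.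
Proof.
have -> : z * w = gmul z w by [].
rewrite /gmul raddf_sum; apply: le_trans (le_normc_sum _ _) _.
apply: ler_sum => A _; rewrite raddf_sum; apply: le_trans (le_normc_sum _ _) _.
rewrite [leRHS]big_mkcond; apply: ler_sum => B _.
rewrite /= mcoeffU normcMn !Normc.normcM normc_blade_sign /blade_kernel.
by case: [disjoint A & B]%fset; case: eqP; rewrite ?mulr1 ?mulr0 ?mul0rn.
Qed.

Lemma pnormXn n z :
  pnorm n.+1%:R z ^+ n.+1 = \sum_(A <- msupp z) normc z@_A ^+ n.+1.
Proof. exact: (lpnormXn (msupp z) n (fun A => normc_ge0 z@_A)). Qed.

Lemma pnorm1E z : pnorm 1 z = \sum_(A <- msupp z) normc z@_A.
Proof. exact: (pnormXn 0). Qed.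

(** Stated for any [u] dominated by the kernel sum, so that it serves the product with either factor
    in the role of the weights, although the product is not commutative. *)
Lemma pnorm_kernel_exp u z w n :
  (forall C, normc u@_C <= \sum_(A <- msupp z)
     normc z@_A * \sum_(B <- msupp w | blade_kernel A B C) normc w@_B) ->
  pnorm n.+1%:R u ^+ n.+1 <= pnorm 1 z ^+ n.+1 * pnorm n.+1%:R w ^+ n.+1.
Proof.
move=> uzw; rewrite [leLHS]pnormXn [X in _ <= X ^+ _ * _]pnorm1E.
rewrite [X in _ * X]pnormXn.
apply: le_trans (@kernel_young _ _ _ _ blade_kernel (msupp z) (msupp w)
  (msupp u) (fun A => normc z@_A) (fun B => normc w@_B) n (fset_uniq _)
  (fset_uniq _) blade_kernel_inj blade_kernel_fun
  (fun A => normc_ge0 _) (fun B => normc_ge0 _)).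
apply: ler_sum => C _; rewrite lerXn2r ?nnegrE ?normc_ge0 //.
by apply: le_trans (uzw C); apply: normc_ge0.
Qed.

Lemma pnormMl_exp z w n :
  pnorm n.+1%:R (z * w) ^+ n.+1 <=
  pnorm 1 z ^+ n.+1 * pnorm n.+1%:R w ^+ n.+1.
Proof.
apply: pnorm_kernel_exp => C; apply: le_trans (normc_mcoeffM _ _ _) _.
by apply: ler_sum => A _; rewrite mulr_sumr.
Qed.

Lemma pnormMr_exp z w n :
  pnorm n.+1%:R (z * w) ^+ n.+1 <=
  pnorm 1 w ^+ n.+1 * pnorm n.+1%:R z ^+ n.+1.
Proof.
apply: pnorm_kernel_exp => C; apply: le_trans (normc_mcoeffM _ _ _) _.
(* The bound on moduli is symmetric in the two factors, because [blade_kernel] ignores the signs. *)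
rewrite (exchange_big_dep xpredT) //=; apply: ler_sum => B _.
rewrite mulr_sumr; under eq_bigl do rewrite blade_kernelC.
by under eq_bigr do rewrite mulrC.
Qed.

Lemma pnorm_dyadic_holder z n :
  pnorm n.+1%:R z ^+ n.+1 <=
  pnorm (2 ^+ n) z * \prod_(1 <= k < n.+1) pnorm (2 ^+ k) z.
Proof.
rewrite pnormXn.
exact: (lpnorm_dyadic_holder (msupp z) n (fun A => normc_ge0 z@_A)).
Qed.

End GrassmannNorm.

Theorem theorem2p15 (R : realType) (z w : grassmann R) (p : nat)
    (hp : (1 <= p)%N) :
  (p = 1%N -> pnorm 1 (z * w) <= pnorm 1 z * pnorm 1 w) /\
  ((1 < p)%N ->
    pnorm p%:R (z * w) ^+ p <=
      pnorm 1 z ^+ p *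
      (pnorm (2 ^+ p.-1) w * \prod_(1 <= k < p) pnorm (2 ^+ k) w) /\
    pnorm p%:R (z * w) ^+ p <=
      pnorm 1 w ^+ p *
      (pnorm (2 ^+ p.-1) z * \prod_(1 <= k < p) pnorm (2 ^+ k) z)).
Proof.
have norm1_ge0 (u : grassmann R) : 0 <= pnorm 1 u by apply: lpnorm_ge0.
split=> [_|_]; first exact: (pnormMl_exp z w 0).
case: p hp => // n _; split.
  apply: le_trans (pnormMl_exp z w n) _.
  apply: ler_wpM2l; [exact: exprn_ge0 | exact: pnorm_dyadic_holder].
apply: le_trans (pnormMr_exp z w n) _.
apply: ler_wpM2l; [exact: exprn_ge0 | exact: pnorm_dyadic_holder].
Qed.
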